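(* Let $T\ge 1$ be an integer, $0<c_1\le c_2$ real numbers, $\{R_k\}_{k\in N_T}$ a sequence of real symmetric positive definite $n\times n$ matrices, and $\{A_k\}_{k\in N_{T-1}},\{C_k\}_{k\in N_{T-1}}$ real $n\times n$ matrices. Suppose there exist a scalar $\alpha\ge 0$ and a sequence of symmetric positive definite $n\times n$ matrices $\{P_k\}_{k\in N_T}$ such that $$(\alpha+1)^Tc_1\overline{\lambda}-c_2\underline{\lambda}<0,$$ $$A_j'R_{j+1}^{\frac12}P_{j+1}R_{j+1}^{\frac12}A_j+C_j'R_{j+1}^{\frac12}P_{j+1}R_{j+1}^{\frac12}C_j-(\alpha+1)R_j^{\frac12}P_jR_j^{\frac12}<0,\quad j\in N_{T-1},$$ where $\underline{\lambda}=\min_{k\in N_T}\lambda_{\min}(P_k)$ and $\overline{\lambda}=\lambda_{\max}(P_0)$. Then the system $x_{k+1}=A_kx_k+C_kx_kw_k$, $x_0\in\mathbb{R}^n$, $k\in N_{T-1}$, is finite-time stable with respect to $(c_1,c_2,T,\{R_k\}_{k\in N_T})$.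
   Context: $N_T:=\{0,1,\dots,T\}$. $M'$ is the transpose; $M<0$ for a symmetric matrix means negative definite; $R^{1/2}$ is the symmetric positive definite square root; $\lambda_{\min},\lambda_{\max}$ are the minimum and maximum eigenvalues of a real symmetric matrix. $\|x\|_R^2:=x'Rx$. $\{w_k\}_{k\in N_{T-1}}$ is a sequence of independent real random variables on a complete probability space with $E[w_k]=0$ and $E[w_kw_j]=\delta_{kj}$ (Kronecker delta); $x_0$ is deterministic. Finite-time stability: the system is finite-time stable with respect to $(c_1,c_2,T,\{R_k\}_{k\in N_T})$ if for every deterministic $x_0\in\mathbb{R}^n$, $\|x_0\|_{R_0}^2\le c_1$ implies $E\|x_k\|_{R_k}^2<c_2$ for all $k\in N_T$. *)

(* Defs.v *)
From HB Require Import structures.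
From mathcomp Require Import all_boot all_order all_algebra finmap.
From mathcomp Require Import all_classical all_reals all_analysis.

Set Implicit Arguments.
Unset Strict Implicit.
Unset Printing Implicit Defensive.

Import Order.TTheory GRing.Theory Num.Theory.
Import numFieldNormedType.Exports.
Local Open Scope classical_set_scope.
Local Open Scope ring_scope.

(* The quadratic form x' Q x, also written ||x||_Q^2. *)
Definition quadform (R : realType) (n : nat) (Q : 'M[R]_n) (x : 'cV[R]_n) : R :=
  (x^T *m Q *m x) ord0 ord0.

Definition posdefmx (R : realType) (n : nat) (M : 'M[R]_n) : Prop :=
  M^T = M /\ forall x : 'cV[R]_n, x != 0 -> 0 < quadform M x.

Definition negdefmx (R : realType) (n : nat) (M : 'M[R]_n) : Prop :=
  M^T = M /\ forall x : 'cV[R]_n, x != 0 -> quadform M x < 0.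

(* The symmetric positive definite square root; xget falls back on the junk
   value 0 when there is none, i.e. when M is not positive definite. *)
Definition sqrtmx (R : realType) (n : nat) (M : 'M[R]_n) : 'M[R]_n :=
  xget 0 [set S | posdefmx S /\ S *m S = M].

(* For M symmetric and n > 0 the set of eigenvalues is finite and nonempty, so
   inf and sup are its minimum and maximum. *)
Definition lambda_min (R : realType) (n : nat) (M : 'M[R]_n) : R :=
  inf [set a | eigenvalue M a].

Definition lambda_max (R : realType) (n : nat) (M : 'M[R]_n) : R :=
  sup [set a | eigenvalue M a].

Definition mutually_independent (d : measure_display) (Omega : measurableType d)
    (R : realType) (Pr : probability Omega R) (I : choiceType) (D : set I)
    (X : I -> {RV Pr >-> R}) : Prop :=
  forall (J : {fset I}) (B : I -> set R),
    [set` J] `<=` D ->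
    (forall i, i \in J -> measurable (B i)) ->
    Pr (\bigcap_(i in [set` J]) (X i @^-1` B i)) =
      (\prod_(i <- J) Pr (X i @^-1` B i))%E.

(* x_(k+1) = A_k x_k + C_k x_k w_k started at x0, solved pathwise. *)
Fixpoint state (R : realType) (n : nat) (Omega : Type) (A C : nat -> 'M[R]_n)
    (w : nat -> Omega -> R) (x0 : 'cV[R]_n) (k : nat) (omega : Omega)
    : 'cV[R]_n :=
  if k is j.+1 then
    let x := state A C w x0 j omega in A j *m x + w j omega *: (C j *m x)
  else x0.

(* X x0 is the trajectory started at the deterministic x0, and Q k is the
   weight at time k.  The expectation lives in \bar R, so the conclusion
   entails that it is finite. *)
Definition finite_time_stable (d : measure_display) (Omega : measurableType d)
    (R : realType) (Pr : probability Omega R) (n : nat)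
    (X : 'cV[R]_n -> nat -> Omega -> 'cV[R]_n)
    (c1 c2 : R) (T : nat) (Q : nat -> 'M[R]_n) : Prop :=
  forall x0 : 'cV[R]_n, quadform (Q 0%N) x0 <= c1 ->
  forall k : nat, (k <= T)%N ->
    ('E_Pr[fun omega => quadform (Q k) (X x0 k omega)] < c2%:E)%E.

(* Main.v *)
Require Import Defs.
From HB Require Import structures.
From mathcomp Require Import all_boot all_order all_algebra finmap.
From mathcomp Require Import all_classical all_reals all_analysis.
From mathcomp Require Import measurable_realfun complex ring lra.

Set Implicit Arguments.
Unset Strict Implicit.
Unset Printing Implicit Defensive.

Import Order.TTheory GRing.Theory Num.Theory.
Import numFieldNormedType.Exports.
Local Open Scope classical_set_scope.
Local Open Scope ring_scope.

(** The weighted form V_k(x) = x' W_k x, with W_k = Q_k^(1/2) P_k Q_k^(1/2), is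
    a stochastic Lyapunov function.  Expanding V_(k+1)(A x + w C x) gives a
    constant term, a term linear in w and a term quadratic in w.  The state x_k
    depends on w_0, ..., w_(k-1) only, hence is independent of w_k; as w_k has
    mean 0 and variance 1,
      E V_(k+1)(x_(k+1)) = E x_k' (A_k' W_(k+1) A_k + C_k' W_(k+1) C_k) x_k,
    and the matrix inequality bounds this by (alpha + 1) E V_k(x_k).  Iterating,
    E V_k(x_k) <= (alpha + 1)^k V_0(x_0).  The substitution y = Q_k^(1/2) x
    turns V_k into y' P_k y and the weighted norm x' Q_k x into y' y, so that the
    Rayleigh bounds (weighted_ge, weighted_le) compare both ends of this chain
    with the weighted norms, and the scalar condition concludes.

    The linear algebra rests on diagonalizing real symmetric matrices
    (symmetric_diagonalizable).  It yields the square roots of matrices with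
    nonnegative eigenvalues (psd_sqrt), from which come both the existence of
    Q_k^(1/2) (sqrtmxP) and the Rayleigh bounds: A - m I is a square S S with S
    symmetric as soon as m is below all the eigenvalues of A.

    The probability rests on two facts.  Independence of the family w passes
    from finite intersections to the sigma-algebra generated by the past, by the
    uniqueness theorem for measures agreeing on a pi-system (past_independent);
    and two independent integrable variables have an integrable product whose
    expectation is the product of the expectations (independent_mul), because
    their joint law is a product measure to which Fubini's theorem applies.  All
    quadratic forms of x_k are treated at once, by induction on k, which avoids
    any discussion of the individual coordinates of the state. *)

(** * Spectral theory of real symmetric matrices *)

Section spectral.
Variable R : realType.
Local Notation toC := (real_complex R).

Lemma mxOver_real_complex m n (M : 'M[R[i]]_(m, n)) :
  M \is a mxOver Num.real -> exists N : 'M[R]_(m, n), M = map_mx toC N.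
Proof.
move=> /mxOverP Mreal; exists (map_mx (@complex.Re R) M).
by apply/matrixP => i j; rewrite !mxE RRe_real.
Qed.

(** Over R[i] the matrix is Hermitian, hence diagonalizable with a real
    diagonal; two real matrices that are similar over R[i] are similar over R. *)
Lemma symmetric_diagonalizable n (A : 'M[R]_n) : A^T = A ->
  exists (P : 'M[R]_n) (D : 'rV[R]_n),
    P \in unitmx /\ A = invmx P *m diag_mx D *m P.
Proof.
move=> Asym; pose B := map_mx toC A.
have Breal : B \is a mxOver Num.real.
  by apply/mxOverP => i j; rewrite mxE; apply/complex_realP; exists (A i j).
have Bherm : B \is hermsymmx.
  rewrite is_hermitianmxE expr0 scale1r; apply/eqP.
  by rewrite (_ : B^T = B) ?realmxC // /B map_trmx Asym.
have /orthomx_spectralP BE := hermitian_normalmx Bherm.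
have Dreal := hermitian_spectral_diag_real Bherm.
set U := spectralmx B in BE; set d := spectral_diag B in BE Dreal.
have Uu : U \in unitmx by exact: spectral_unit.
have dreal : diag_mx d \is a mxOver Num.real by rewrite mxOver_diag ?real0.
have UB : similar_in unitmx B (diag_mx d).
  exists U => //; apply/similarP => //.
  by rewrite {1}BE -!mulmxA mulKVmx.
have [V /andP[Vreal Vu] /(similarP Vu) VB] := real_similar UB Breal dreal.
have [P VE] := mxOver_real_complex Vreal.
have [D dE] := mxOver_real_complex Dreal.
have Pu : P \in unitmx by rewrite -(map_unitmx toC) -VE.
exists P, D; split=> //; rewrite -mulmxA; apply: (canRL (mulKmx Pu)).
apply: (@map_mx_inj _ _ toC).
by rewrite !map_mxM map_diag_mx -VE -dE.
Qed.

Lemma eigenvalue_diagonalized n (A P : 'M[R]_n) (D : 'rV[R]_n) a :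
  P \in unitmx -> A = invmx P *m diag_mx D *m P ->
  eigenvalue A a <-> exists i, a = D 0 i.
Proof.
move=> Pu AE; split.
- move=> /eigenvalueP[v vA v0]; pose u := v *m invmx P.
  have uD : u *m diag_mx D = a *: u.
    by rewrite /u scalemxAl -vA AE !mulmxA mulmxK.
  have [i ui] : exists i, u 0 i != 0.
    apply/rV0Pn; apply: contra v0 => /eqP u0.
    by rewrite -(mulmxKV Pu v) -/u u0 mul0mx.
  exists i; have /rowP/(_ i) := uD.
  by rewrite mul_mx_diag mxE [RHS]mxE mulrC => /(mulIf ui).
- (* A row of P is an eigenvector, and is nonzero since P is invertible. *)
  move=> [i ->]; apply/eigenvalueP; exists (row i P).
    rewrite AE -row_mul -!mulmxA mulKVmx // row_mul row_diag_mx.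
    by rewrite -scalemxAl -rowE.
  apply: contraTneq Pu => Pi0.
  rewrite unitmxE (expand_det_row _ i) big1 ?unitr0 //.
  by move=> j _; have /rowP/(_ j) := Pi0; rewrite !mxE => ->; rewrite mul0r.
Qed.

(** P need not be orthogonal.  The matrix P^-1 E P with E diagonal is symmetric
    exactly when the Gram matrix P P' commutes with E, and a matrix commuting
    with the diagonal matrix D also commutes with its entrywise image f(D). *)
Lemma trmx_functional_calculus n (A P : 'M[R]_n) (D : 'rV[R]_n) (f : R -> R) :
  A^T = A -> P \in unitmx -> A = invmx P *m diag_mx D *m P ->
  let fA := invmx P *m diag_mx (map_mx f D) *m P in fA^T = fA.
Proof.
move=> Asym Pu AE; pose G := P *m P^T.
have symE E : (invmx P *m diag_mx E *m P)^T = invmx P *m diag_mx E *m P <->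
    G *m diag_mx E = diag_mx E *m G.
  rewrite !trmx_mul tr_diag_mx trmx_inv mulmxA.
  have Ptu : P^T \in unitmx by rewrite unitmx_tr.
  rewrite /G; split => H.
    rewrite -[LHS](mulmxKV Ptu).
    have -> : P *m P^T *m diag_mx E *m invmx P^T =
        P *m (P^T *m diag_mx E *m invmx P^T) by rewrite !mulmxA.
    by rewrite H !mulmxA mulmxV // mul1mx.
  apply: (canLR (mulmxK Ptu)); rewrite -!mulmxA; apply: (canRL (mulKmx Pu)).
  by rewrite !mulmxA H mulmxA.
have /symE GD :
    (invmx P *m diag_mx D *m P)^T = invmx P *m diag_mx D *m P by rewrite -AE.
apply/symE.
apply/matrixP => i j; have /matrixP/(_ i j) := GD.
rewrite !mul_mx_diag !mul_diag_mx mxE [RHS]mxE => GDij.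
rewrite mxE [RHS]mxE [LHS]mulrC.
move: GDij; rewrite [LHS]mulrC.
have [->|Gij] := eqVneq (G i j) 0; first by rewrite !mulr0.
by move/(mulIf Gij) => Dij; rewrite !mxE Dij.
Qed.

(** The root is the functional calculus of the square root function.  The
    eigenvalues are recorded because the root of a positive definite matrix has
    to be shown positive definite (posdefmx_sqrt). *)
Lemma psd_sqrt n (A : 'M[R]_n) :
  A^T = A -> (forall a, eigenvalue A a -> 0 <= a) ->
  exists S : 'M[R]_n,
    [/\ S^T = S, S *m S = A & forall a, eigenvalue S a -> 0 <= a].
Proof.
move=> Asym A0; have [P [D [Pu AE]]] := symmetric_diagonalizable Asym.
exists (invmx P *m diag_mx (map_mx Num.sqrt D) *m P); split.
- exact: trmx_functional_calculus AE.
- rewrite !mulmxA mulmxK // -(mulmxA (invmx P)) mulmx_diag AE.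
  congr (_ *m diag_mx _ *m _); apply/rowP => i.
  rewrite !mxE -expr2 sqr_sqrtr //.
  by apply: A0; apply/(eigenvalue_diagonalized _ Pu AE); exists i.
- move=> a /(eigenvalue_diagonalized _ Pu erefl)[i ->].
  by rewrite mxE sqrtr_ge0.
Qed.

(** * Quadratic forms and extreme eigenvalues *)

Lemma quadformD n (M N : 'M[R]_n) x :
  quadform (M + N) x = quadform M x + quadform N x.
Proof. by rewrite /quadform mulmxDr mulmxDl mxE. Qed.

Lemma quadformZ n a (M : 'M[R]_n) x : quadform (a *: M) x = a * quadform M x.
Proof. by rewrite /quadform -scalemxAr -scalemxAl mxE. Qed.

Lemma quadformN n (M : 'M[R]_n) x : quadform (- M) x = - quadform M x.
Proof. by rewrite -scaleN1r quadformZ mulN1r. Qed.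

Lemma quadform0 n (M : 'M[R]_n) : quadform M 0 = 0.
Proof. by rewrite /quadform mulmx0 mxE. Qed.

Lemma quadform_congr n (S M : 'M[R]_n) x :
  quadform (S^T *m M *m S) x = quadform M (S *m x).
Proof. by rewrite /quadform trmx_mul !mulmxA. Qed.

Lemma quadform1E n (x : 'cV[R]_n) : quadform 1%:M x = \sum_i x i ord0 ^+ 2.
Proof.
by rewrite /quadform mulmx1 mxE; apply: eq_bigr => i _; rewrite mxE expr2.
Qed.

Lemma quadform1_ge0 n (x : 'cV[R]_n) : 0 <= quadform 1%:M x.
Proof. by rewrite quadform1E sumr_ge0 // => i _; rewrite sqr_ge0. Qed.

Lemma quadform1_eq0 n (x : 'cV[R]_n) : (quadform 1%:M x == 0) = (x == 0).
Proof.
apply/eqP/eqP => [|->]; last exact: quadform0.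
rewrite quadform1E => /psumr_eq0P x0; apply/colP => i; rewrite mxE.
by apply/eqP; rewrite -sqrf_eq0 x0 // => j _; rewrite sqr_ge0.
Qed.

Lemma quadform_ge0 n (A : 'M[R]_n) x :
  A^T = A -> (forall a, eigenvalue A a -> 0 <= a) -> 0 <= quadform A x.
Proof.
move=> Asym /(psd_sqrt Asym)[S [Ssym SS _]].
by rewrite -SS -{1}Ssym -(mulmx1 S^T) quadform_congr quadform1_ge0.
Qed.

(** The eigenvalues of A - m I are those of A shifted by m, so this matrix has a
    nonnegative quadratic form. *)
Lemma rayleigh_ge n (A : 'M[R]_n) m x :
  A^T = A -> (forall a, eigenvalue A a -> m <= a) ->
  m * quadform 1%:M x <= quadform A x.
Proof.
move=> Asym mA; rewrite -subr_ge0 -quadformZ -quadformN -quadformD.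
apply: quadform_ge0 => [|a]; first by rewrite linearB linearZ /= trmx1 Asym.
move=> /eigenvalueP[v vA v0].
rewrite -(lerD2r m) add0r; apply: mA; apply/eigenvalueP; exists v => //.
rewrite scalerDl -vA mulmxDr -scaleN1r -!scalemxAr mulmx1.
by rewrite scalerA mulN1r -addrA -scalerDl addNr scale0r addr0.
Qed.

Lemma quadform_eigenvector n (A : 'M[R]_n) a (v : 'rV[R]_n) :
  v *m A = a *: v -> quadform A v^T = a * quadform 1%:M v^T.
Proof. by move=> vA; rewrite /quadform trmxK vA -scalemxAl mulmx1 mxE. Qed.

Lemma posdefmx_eigenvalue_gt0 n (A : 'M[R]_n) a :
  posdefmx A -> eigenvalue A a -> 0 < a.
Proof.
move=> [_ A0] /eigenvalueP[v vA v0].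
have vt0 : v^T != 0 by rewrite trmx_eq0.
have := A0 _ vt0; rewrite (quadform_eigenvector vA) pmulr_lgt0 //.
by rewrite lt_def quadform1_ge0 quadform1_eq0 vt0.
Qed.

Lemma least_eigenvalue n (A : 'M[R]_n) : A^T = A -> (0 < n)%N ->
  exists2 m, eigenvalue A m & forall a, eigenvalue A a -> m <= a.
Proof.
move=> Asym n0; have [P [D [Pu AE]]] := symmetric_diagonalizable Asym.
have EP a := eigenvalue_diagonalized a Pu AE.
have [i _ iD] := @Order.TotalTheory.arg_minP _ _ _ (Ordinal n0) xpredT (D 0) isT.
exists (D 0 i); first by apply/EP; exists i.
by move=> a /EP[j ->]; exact: iD.
Qed.

Lemma lambda_minP n (A : 'M[R]_n) : A^T = A -> (0 < n)%N ->
  eigenvalue A (lambda_min A) /\ forall a, eigenvalue A a -> lambda_min A <= a.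
Proof.
move=> Asym n0; have [m Am mA] := least_eigenvalue Asym n0.
suff -> : lambda_min A = m by [].
apply/eqP; rewrite eq_le; apply/andP; split.
  by apply: ge_inf => //; exists m => a /mA.
by apply: lb_le_inf; [exists m|move=> a /mA].
Qed.

Lemma eigenvalueN n (A : 'M[R]_n) a : eigenvalue (- A) a -> eigenvalue A (- a).
Proof.
move=> /eigenvalueP[v vA v0]; apply/eigenvalueP; exists v => //.
by rewrite scaleNr -vA mulmxN opprK.
Qed.

(** Without an upper bound on the set of eigenvalues its supremum would be the
    default value 0; the opposite of a least eigenvalue of - A is such a bound. *)
Lemma lambda_max_ge n (A : 'M[R]_n) a : A^T = A -> (0 < n)%N ->
  eigenvalue A a -> a <= lambda_max A.
Proof.
move=> Asym n0 Aa; apply: ub_le_sup => //.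
have NAsym : (- A)^T = - A by rewrite linearN /= Asym.
have [m _ mA] := least_eigenvalue NAsym n0.
exists (- m) => b; rewrite -{1}[A]opprK => /eigenvalueN /mA.
by rewrite lerNr.
Qed.

Lemma lambda_min_quadform n (A : 'M[R]_n) x : A^T = A -> (0 < n)%N ->
  lambda_min A * quadform 1%:M x <= quadform A x.
Proof.
by move=> Asym n0; apply: rayleigh_ge => //; case: (lambda_minP Asym n0).
Qed.

Lemma lambda_max_quadform n (A : 'M[R]_n) x : A^T = A -> (0 < n)%N ->
  quadform A x <= lambda_max A * quadform 1%:M x.
Proof.
move=> Asym n0; rewrite -lerN2 -quadformN -mulNr; apply: rayleigh_ge.
  by rewrite linearN /= Asym.
by move=> a /eigenvalueN /(lambda_max_ge Asym n0); rewrite lerNl.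
Qed.

(** The root S has no eigenvalue 0, since Q = S S would have it too; its least
    eigenvalue is then positive and bounds its quadratic form from below. *)
Lemma posdefmx_sqrt n (Q : 'M[R]_n) : (0 < n)%N -> posdefmx Q ->
  exists2 S, posdefmx S & S *m S = Q.
Proof.
move=> n0 Qpos.
have Q0 a : eigenvalue Q a -> 0 <= a.
  by move=> /(posdefmx_eigenvalue_gt0 Qpos)/ltW.
have [S [Ssym SS S0]] := psd_sqrt Qpos.1 Q0.
exists S => //; split=> // x x0.
have [Smin _] := lambda_minP Ssym n0.
have Sgt0 : 0 < lambda_min S.
  rewrite lt_def S0 // andbT; apply: contraTneq isT => Smin0.
  move: Smin; rewrite Smin0 => /eigenvalueP[v vS v0].
  suff : eigenvalue Q 0 by move=> /(posdefmx_eigenvalue_gt0 Qpos); rewrite ltxx.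
  by apply/eigenvalueP; exists v => //; rewrite -SS mulmxA vS !scale0r mul0mx.
apply: lt_le_trans (lambda_min_quadform x Ssym n0).
by rewrite mulr_gt0 // lt_def quadform1_ge0 quadform1_eq0 x0.
Qed.

Lemma sqrtmxP n (Q : 'M[R]_n) : (0 < n)%N -> posdefmx Q ->
  (sqrtmx Q)^T = sqrtmx Q /\ sqrtmx Q *m sqrtmx Q = Q.
Proof.
move=> n0 Qpos; have [S Spos SS] := posdefmx_sqrt n0 Qpos.
have [[sym _] sq] : [set S | posdefmx S /\ S *m S = Q] (sqrtmx Q).
  by apply: xgetPex; exists S.
by [].
Qed.

Lemma quadform_sqrt n (Q P : 'M[R]_n) x : (0 < n)%N -> posdefmx Q ->
  quadform (sqrtmx Q *m P *m sqrtmx Q) x = quadform P (sqrtmx Q *m x).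
Proof.
by move=> n0 /(sqrtmxP n0)[S _]; rewrite -quadform_congr S.
Qed.

Lemma quadform_weight n (Q : 'M[R]_n) x : (0 < n)%N -> posdefmx Q ->
  quadform Q x = quadform 1%:M (sqrtmx Q *m x).
Proof.
move=> n0 Qpos; rewrite -quadform_sqrt // mulmx1.
by rewrite (sqrtmxP n0 Qpos).2.
Qed.

Lemma weighted_ge n (Q P : 'M[R]_n) x : (0 < n)%N -> posdefmx Q -> posdefmx P ->
  lambda_min P * quadform Q x <= quadform (sqrtmx Q *m P *m sqrtmx Q) x.
Proof.
move=> n0 Qpos [Psym _]; rewrite quadform_sqrt // (quadform_weight _ n0 Qpos).
exact: lambda_min_quadform.
Qed.

Lemma weighted_le n (Q P : 'M[R]_n) x : (0 < n)%N -> posdefmx Q -> posdefmx P ->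
  quadform (sqrtmx Q *m P *m sqrtmx Q) x <= lambda_max P * quadform Q x.
Proof.
move=> n0 Qpos [Psym _]; rewrite quadform_sqrt // (quadform_weight _ n0 Qpos).
exact: lambda_max_quadform.
Qed.

End spectral.

(** * Expectation of a product of independent variables *)

Section product_expectation.
Context (d : measure_display) (Omega : measurableType d) (R : realType).
Variable Pr : probability Omega R.

Definition independent2 (X Y : Omega -> R) : Prop :=
  forall A B, measurable A -> measurable B ->
    Pr (X @^-1` A `&` Y @^-1` B) = (Pr (X @^-1` A) * Pr (Y @^-1` B))%E.

(** The two integrals are first computed for random variables, whose laws are
    available as measures; independent_mul extends this to plain functions. *)
Variables X Y : {RV Pr >-> R}.
Hypothesis XY : independent2 X Y.

Let XY_pair (w : Omega) : R * R := (X w, Y w).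

Let measurable_XY_pair : measurable_fun setT XY_pair.
Proof. exact: measurable_fun_pair. Qed.

Let joint := (distribution Pr X \x distribution Pr Y)%E.

Let jointE A : measurable A -> joint A = pushforward Pr XY_pair A.
Proof. by move=> mA; apply: product_measure_unique. Qed.

Let mul (z : R * R) : \bar R := (z.1 * z.2)%:E.

Let mmul : measurable_fun [set: R * R] mul.
Proof. by apply/measurable_EFinP; apply: measurable_funM. Qed.

Let mX : measurable_fun setT X. Proof. exact: measurable_funPT. Qed.
Let mY : measurable_fun setT Y. Proof. exact: measurable_funPT. Qed.

Let joint_eq (f : R * R -> \bar R) :
  (\int[joint]_z f z = \int[pushforward Pr XY_pair]_z f z)%E.
Proof. by apply: eq_measure_integral => A mA _; exact: jointE. Qed.

Let distr_norm (Z : {RV Pr >-> R}) :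
  (\int[distribution Pr Z]_z `|z%:E| = \int[Pr]_w `|(Z w)%:E|)%E.
Proof.
rewrite (@ge0_integral_distribution _ _ _ _ _ Pr Z (fun z => `|z%:E|%E)) //.
exact: measurableT_comp.
Qed.

(** Tonelli's theorem for the product of the absolute values. *)
Let norm_joint : (\int[Pr]_w `|(X w * Y w)%:E| =
  (\int[Pr]_w `|(X w)%:E|) * (\int[Pr]_w `|(Y w)%:E|))%E.
Proof.
have mnormmul : measurable_fun [set: R * R] (fun z => `|mul z|%E).
  exact: measurableT_comp.
transitivity (\int[joint]_z `|mul z|)%E.
  by rewrite joint_eq ge0_integral_pushforward.
rewrite fubini_tonelli1 // /fubini_F /mul /=.
under eq_integral => x _.
  under eq_integral => y _ do rewrite normrM EFinM.
  rewrite ge0_integralZl_EFin //; last first.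
    by apply/measurable_EFinP; exact: normr_measurable.
  over.
rewrite ge0_integralZr //=; last 2 first.
- by apply/measurable_EFinP; exact: normr_measurable.
- by apply: integral_ge0.
by rewrite -distr_norm -distr_norm.
Qed.

Lemma integrable_independent_mul :
  Pr.-integrable setT (EFin \o X) -> Pr.-integrable setT (EFin \o Y) ->
  Pr.-integrable setT (fun w => (X w * Y w)%:E).
Proof.
move=> iX iY; apply/integrableP; split.
  by apply/measurable_EFinP; apply: measurable_funM.
rewrite norm_joint lte_mul_pinfty ?integral_ge0 //.
- by have := integrable_fin_num measurableT (integrable_abse iX); exact.
- by have /integrableP[] := iY.
Qed.

Lemma expectation_independent_mul :
  Pr.-integrable setT (EFin \o X) -> Pr.-integrable setT (EFin \o Y) ->
  ('E_Pr[(fun w => X w * Y w)%R] = 'E_Pr[X] * 'E_Pr[Y])%E.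
Proof.
move=> iX iY; have iXY := integrable_independent_mul iX iY.
have dE (Z : {RV Pr >-> R}) : Pr.-integrable setT (EFin \o Z) ->
    (\int[distribution Pr Z]_z z%:E = \int[Pr]_w (Z w)%:E)%E.
  by move=> iZ; rewrite (@integral_distribution _ _ _ _ _ Pr Z EFin).
have di (Z : {RV Pr >-> R}) : Pr.-integrable setT (EFin \o Z) ->
    (distribution Pr Z).-integrable setT EFin.
  by move=> iZ; apply: integrable_pushforward.
rewrite unlock.
transitivity (\int[joint]_z mul z)%E.
  by rewrite joint_eq integral_pushforward.
have ijoint : joint.-integrable setT mul.
  apply/integrableP; split=> //.
  have -> : (\int[joint]_z `|mul z| = \int[Pr]_w `|(X w * Y w)%:E|)%E.
    by rewrite joint_eq ge0_integral_pushforward //; exact: measurableT_comp.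
  by have /integrableP[] := iXY.
rewrite -integral12_prod_meas1 // /fubini_F /mul /=.
under eq_integral => x _.
  under eq_integral => y _ do rewrite EFinM.
  rewrite integralZl // ?dE //; last exact: di.
  over.
have fY : (\int[Pr]_w (Y w)%:E)%E \is a fin_num.
  by have := integrable_fin_num measurableT iY.
by rewrite -(fineK fY) integralZr // ?dE //; exact: di.
Qed.
End product_expectation.

Lemma independent_mul (d : measure_display) (Omega : measurableType d)
    (R : realType) (Pr : probability Omega R) (X Y : Omega -> R) :
  independent2 Pr X Y ->
  Pr.-integrable setT (EFin \o X) -> Pr.-integrable setT (EFin \o Y) ->
  Pr.-integrable setT (fun w => (X w * Y w)%:E) /\
  ('E_Pr[(fun w => X w * Y w)%R] = 'E_Pr[X] * 'E_Pr[Y])%E.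
Proof.
move=> XY iX iY.
have mX : measurable_fun setT X.
  by apply/measurable_EFinP; exact: measurable_int iX.
have mY : measurable_fun setT Y.
  by apply/measurable_EFinP; exact: measurable_int iY.
pose X' : {RV Pr >-> R} := mfun_Sub (mem_set mX).
pose Y' : {RV Pr >-> R} := mfun_Sub (mem_set mY).
split; first exact: (@integrable_independent_mul _ _ _ Pr X' Y').
exact: (@expectation_independent_mul _ _ _ Pr X' Y').
Qed.

(** * Independence from the past *)

Section past_independence.
Context (d : measure_display) (Omega : measurableType d) (R : realType).
Variable Pr : probability Omega R.
Variables (I : choiceType) (w : I -> {RV Pr >-> R}).

(** The pi-system generating the sigma-algebra of the w_i with i in S.  Taking B
    equal to setT outside J lets the intersection run over all indices, so that
    two cylinders are intersected pointwise in B. *)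
Definition cylinders (S : set I) : set (set Omega) :=
  [set E | exists (J : {fset I}) (B : I -> set R),
    [/\ [set` J] `<=` S, forall i, measurable (B i),
        forall i, i \notin J -> B i = setT & E = \bigcap_i (w i @^-1` B i)]].

Lemma cylinders_setI S : setI_closed (cylinders S).
Proof.
move=> _ _ [J [B [JS mB BT ->]]] [K [C [KS mC CT ->]]].
exists (J `|` K)%fset, (fun i => B i `&` C i); split.
- by rewrite set_fsetU => i [/JS|/KS].
- by move=> i; exact: measurableI.
- by move=> i; rewrite in_fsetU negb_or => /andP[/BT -> /CT ->]; rewrite setIT.
- apply/seteqP; split=> [x [Bx Cx] i _|x BCx].
    by split; [exact: Bx|exact: Cx].
  by split=> i _; have [] := BCx i Logic.I.
Qed.

Lemma cylinders_setT S : cylinders S setT.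
Proof.
exists fset0, (fun=> setT); split=> //.
by apply/seteqP; split=> // x _ i _.
Qed.

Lemma cylinders_preimage (S : set I) i B : S i -> measurable B ->
  cylinders S (w i @^-1` B).
Proof.
move=> Si mB.
exists [fset i]%fset, (fun j => if j == i then B else setT); split.
- by rewrite set_fset1 => _ ->.
- by move=> j; case: ifP.
- by move=> j; rewrite in_fset1 => /negPf ->.
- apply/seteqP; split=> [x Bx j _ /=|x /(_ i)/(_ Logic.I)/=].
    by case: eqP => // ->.
  by rewrite eqxx.
Qed.

Lemma bigcap_preimage_support (J : {fset I}) (B : I -> set R) :
  (forall i, i \notin J -> B i = setT) ->
  \bigcap_i (w i @^-1` B i) = \bigcap_(i in [set` J]) (w i @^-1` B i).
Proof.
move=> BT; apply/seteqP; split=> x Bx i; first by move=> _; exact: Bx.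
by move=> _; case: (boolP (i \in J)) => [/Bx //|/BT /= ->].
Qed.

Lemma cylinders_measurable S : cylinders S `<=` measurable.
Proof.
move=> _ [J [B [_ mB BT ->]]]; rewrite (bigcap_preimage_support BT).
by apply: fin_bigcap_measurable => // i _; exact: measurable_funPTI.
Qed.

Variables (S D : set I) (k : I).
Hypotheses (w_indep : mutually_independent D w) (SD : S `<=` D).
Hypotheses (Dk : D k) (Sk : ~ S k).

Lemma cylinder_independent E C : cylinders S E -> measurable C ->
  Pr (E `&` w k @^-1` C) = (Pr E * Pr (w k @^-1` C))%E.
Proof.
move=> [J [B [JS mB BT ->]]] mC.
have kJ : k \notin J by apply/negP => /JS.
have capE := bigcap_preimage_support BT.
pose B' i := if i == k then C else B i.
have B'J i : i \in J -> B' i = B i.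
  by rewrite /B'; case: eqP => // -> ; rewrite (negPf kJ).
have mB' i : measurable (B' i) by rewrite /B'; case: ifP.
have kJD : [set` (k |` J)%fset] `<=` D.
  by rewrite set_fsetU1 => i [->//|/JS /SD].
have := w_indep kJD (fun i _ => mB' i).
have prodB' : (\prod_(i <- J) Pr (w i @^-1` B' i) =
    \prod_(i <- J) Pr (w i @^-1` B i))%E.
  by apply: eq_big_seq => i iJ; rewrite B'J.
rewrite set_fsetU1 bigcap_setU1 big_fsetU1 //= prodB'.
rewrite /B' eqxx -/B' setIC muleC.
have -> : \bigcap_(i in [set` J]) (w i @^-1` B' i) = \bigcap_i (w i @^-1` B i).
  by rewrite capE; apply: eq_bigcapr => i iJ; rewrite B'J.
by rewrite capE w_indep // => i /JS /SD.
Qed.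

(** Both sides are finite measures in E, namely a restriction of Pr and a multiple
    of Pr; they agree on the cylinders, hence on the sigma-algebra they
    generate. *)
Lemma past_independent E C : <<s cylinders S >> E -> measurable C ->
  Pr (E `&` w k @^-1` C) = (Pr E * Pr (w k @^-1` C))%E.
Proof.
move=> sE mC; have mwC : measurable (w k @^-1` C) by exact: measurable_funPTI.
have fwC : Pr (w k @^-1` C) \is a fin_num by exact: fin_num_measure.
have p0 : 0 <= fine (Pr (w k @^-1` C)) by rewrite fine_ge0.
rewrite -(fineK fwC) muleC.
apply: (g_sigma_algebra_measure_unique (cylinders S) _ (fun=> setT) _ _
  (mrestr Pr mwC) (mscale (NngNum p0) Pr)) => //.
- exact: cylinders_measurable.
- by move=> _; exact: cylinders_setT.
- exact: bigcup_const.
- exact: cylinders_setI.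
- move=> A cA; rewrite /= /mscale /= fineK // muleC.
  exact: cylinder_independent.
- move=> _; rewrite /= /mrestr setTI.
  by apply: (le_lt_trans (probability_le1 _ _)) => //; exact: ltry.
Qed.

End past_independence.

(** The function g allows both w_k and its square. *)
Lemma adapted_independent (d : measure_display) (Omega : measurableType d)
    (R : realType) (Pr : probability Omega R) (I : choiceType)
    (w : I -> {RV Pr >-> R}) (S D : set I) k
    (X : g_sigma_algebraType (cylinders w S) -> R) (g : R -> R) :
  mutually_independent D w -> S `<=` D -> D k -> ~ S k ->
  measurable_fun setT X -> measurable_fun setT g ->
  independent2 Pr (X : Omega -> R) (g \o w k).
Proof.
move=> wD SD Dk Sk mX mg E F mE mF.
have sE : <<s cylinders w S >> (X @^-1` E).
  by have := mX measurableT E mE; rewrite setTI.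
have mgF : measurable (g @^-1` F).
  by rewrite -[X in measurable X]setTI; exact: mg.
exact: (past_independent wD SD Dk Sk sE mgF).
Qed.

(** * The second moments of the state *)

Section state.
Variables (R : realType) (n : nat) (A C : nat -> 'M[R]_n) (x0 : 'cV[R]_n).

(** Every power of u is multiplied by a quadratic form in x again, so statements
    about all quadratic forms of the state propagate from one time to the next. *)
Lemma quadform_step (M A' C' : 'M[R]_n) (x : 'cV[R]_n) (u : R) :
  quadform M (A' *m x + u *: (C' *m x)) =
  quadform (A'^T *m M *m A') x +
  (quadform (A'^T *m M *m C' + C'^T *m M *m A') x * u +
   quadform (C'^T *m M *m C') x * u ^+ 2).
Proof.
have bilE (a b : 'M[R]_n) :
    (a *m x)^T *m M *m (b *m x) = x^T *m (a^T *m M *m b) *m x.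
  by rewrite trmx_mul !mulmxA.
rewrite quadformD mulrDl /quadform.
rewrite [(_ + _)^T]linearD /= [(_ *: _)^T]linearZ /= !(mulmxDl, mulmxDr).
rewrite -!(scalemxAl, scalemxAr) scalerA -!bilE // !mxE.
ring.
Qed.

(** The measurable structure is arbitrary: it will be the one generated by the
    past, for which this says that the state is adapted. *)
Lemma measurable_quadform_state (d : measure_display) (Omega : measurableType d)
    (w : nat -> Omega -> R) k (M : 'M[R]_n) :
  (forall i, (i < k)%N -> measurable_fun setT (w i)) ->
  measurable_fun setT (fun omega => quadform M (state A C w x0 k omega)).
Proof.
elim: k M => [|k IHk] M mw; first by rewrite /=; exact: measurable_cst.
have {}IHk N :
    measurable_fun setT (fun omega => quadform N (state A C w x0 k omega)).
  by apply: IHk => i ik; apply: mw; exact: ltnW.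
under eq_fun do rewrite /= quadform_step.
have mwk := mw _ (ltnSn k).
apply: measurable_funD => //.
by apply: measurable_funD; apply: measurable_funM => //; exact: measurable_funX.
Qed.

End state.

Section moments.
Context (d : measure_display) (Omega : measurableType d) (R : realType).
Variable Pr : probability Omega R.

Variables (T : nat) (w : nat -> {RV Pr >-> R}).
Hypothesis w_indep : mutually_independent [set k | (k < T)%N] w.
Hypothesis w_mean : forall k, (k < T)%N -> ('E_Pr[w k] = 0%:E)%E.
Hypothesis w_var : forall k, (k < T)%N ->
  ('E_Pr[(fun omega => w k omega ^+ 2)%R] = 1%:E)%E.

Lemma integrable_sqr_noise k : (k < T)%N ->
  Pr.-integrable setT (fun omega => (w k omega ^+ 2)%:E).
Proof.
move=> kT; apply/integrableP; split.
  by apply/measurable_EFinP; apply: measurable_funX; exact: measurable_funPT.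
under eq_integral do rewrite /= ger0_norm ?sqr_ge0 //.
by have := w_var kT; rewrite unlock => ->; exact: ltry.
Qed.

Lemma integrable_noise k : (k < T)%N ->
  Pr.-integrable setT (fun omega => (w k omega)%:E).
Proof.
move=> kT.
apply: (@le_integrable _ _ _ Pr setT _ _
  (fun omega => (1 + w k omega ^+ 2)%:E)) => //.
- by apply/measurable_EFinP; exact: measurable_funPT.
- move=> omega _ /=; rewrite lee_fin [leRHS]ger0_norm; last first.
    by rewrite addr_ge0 ?sqr_ge0.
  rewrite -real_normK ?num_real //; set u := `|_|; nra.
- by apply: (@integrableD _ _ _ Pr setT measurableT (fun=> 1%:E)
    (fun omega => (w k omega ^+ 2)%:E));
    [exact: finite_measure_integrable_cst|exact: integrable_sqr_noise].
Qed.

Variables (n : nat) (A C : nat -> 'M[R]_n) (x0 : 'cV[R]_n).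
Local Notation x := (state A C w x0).

(** Integrability has to be carried along with the formula: multiplying
    expectations of independent variables requires it. *)
Lemma state_step k : (k < T)%N ->
  (forall M, Pr.-integrable setT (fun omega => (quadform M (x k omega))%:E)) ->
  forall M, Pr.-integrable setT (fun omega => (quadform M (x k.+1 omega))%:E) /\
    ('E_Pr[(fun omega => quadform M (x k.+1 omega))%R] =
     'E_Pr[(fun omega => quadform ((A k)^T *m M *m A k + (C k)^T *m M *m C k)
                          (x k omega))%R])%E.
Proof.
move=> kT ik M.
pose S := [set i | (i < k)%N].
have SD : S `<=` [set i | (i < T)%N] by move=> i /= ik'; exact: ltn_trans kT.
have Sk : ~ S k by rewrite /S /= ltnn.
have mx N : measurable_fun setT ((fun omega => quadform N (x k omega)) :
    g_sigma_algebraType (cylinders w S) -> R).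
  apply: (@measurable_quadform_state _ _ _ _ _ _
    (g_sigma_algebraType (cylinders w S)) w) => i ii _ B mB.
  rewrite setTI; apply: sub_sigma_algebra; exact: cylinders_preimage.
have ind1 N : independent2 Pr (fun omega => quadform N (x k omega)) (w k).
  exact: (adapted_independent (g := id) w_indep SD kT Sk (mx N)).
have ind2 N : independent2 Pr (fun omega => quadform N (x k omega))
    (fun omega => w k omega ^+ 2).
  apply: (adapted_independent (g := fun u => u ^+ 2) w_indep SD kT Sk (mx N)).
  exact: measurable_funX.
pose N1 := (A k)^T *m M *m A k.
pose N2 := (A k)^T *m M *m C k + (C k)^T *m M *m A k.
pose N3 := (C k)^T *m M *m C k.
have [i2 E2] := independent_mul (ind1 N2) (ik N2) (integrable_noise kT).
have [i3 E3] := independent_mul (ind2 N3) (ik N3) (integrable_sqr_noise kT).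
have xE omega : quadform M (x k.+1 omega) = quadform N1 (x k omega) +
    (quadform N2 (x k omega) * w k omega +
     quadform N3 (x k omega) * w k omega ^+ 2).
  by rewrite /= quadform_step.
have i23 := integrableD measurableT i2 i3.
split.
  have := integrableD measurableT (ik N1) i23.
  by apply: eq_integrable => // omega _; rewrite xE.
have L1 (f : Omega -> R) : Pr.-integrable setT (EFin \o f) -> f \in Lfun Pr 1.
  by move=> ?; exact/Lfun1_integrable.
under eq_fun do rewrite xE.
under [in RHS]eq_fun do rewrite quadformD.
rewrite (expectationD (L1 _ (ik N1)) (L1 _ i23)).
rewrite (expectationD (L1 _ i2) (L1 _ i3)).
rewrite E2 E3 w_mean // w_var // mule0 add0e mule1.
by rewrite (expectationD (L1 _ (ik N1)) (L1 _ (ik N3))).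
Qed.

Lemma integrable_state k M : (k <= T)%N ->
  Pr.-integrable setT (fun omega => (quadform M (x k omega))%:E).
Proof.
elim: k M => [|k IHk] M kT.
  by rewrite /=; exact: finite_measure_integrable_cst.
by apply: (state_step kT _ M).1 => N; apply: IHk; exact: ltnW.
Qed.

Lemma state_expectation k M : (k < T)%N ->
    ('E_Pr[(fun omega => quadform M (x k.+1 omega))%R] =
     'E_Pr[(fun omega => quadform ((A k)^T *m M *m A k + (C k)^T *m M *m C k)
                          (x k omega))%R])%E.
Proof.
move=> kT; apply: (state_step kT _ M).2 => N.
by apply: integrable_state; exact: ltnW.
Qed.

End moments.

(** * The Lyapunov argument *)

Lemma negdefmx_le0 (R : realType) n (M : 'M[R]_n) x :
  negdefmx M -> quadform M x <= 0.
Proof.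
move=> [_ M0]; have [->|x0] := eqVneq x 0; first by rewrite quadform0.
exact: ltW (M0 _ x0).
Qed.

Theorem theorem4 (R : realType) (d : measure_display) (Omega : measurableType d)
    (Pr : probability Omega R) (Pr_complete : measure_is_complete Pr)
    (n : nat) (n_gt0 : (0 < n)%N) (T : nat) (T_gt0 : (0 < T)%N)
    (w : nat -> {RV Pr >-> R})
    (w_indep : mutually_independent [set k | (k < T)%N] w)
    (w_mean : forall k, (k < T)%N -> ('E_Pr[w k] = 0%:E)%E)
    (w_cov : forall k j, (k < T)%N -> (j < T)%N ->
       ('E_Pr[(fun omega => w k omega * w j omega)%R] = (k == j)%:R%:E)%E)
    (c1 c2 : R) (c1_gt0 : 0 < c1) (c1_le_c2 : c1 <= c2)
    (Q : nat -> 'M[R]_n) (Q_posdef : forall k, (k <= T)%N -> posdefmx (Q k))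
    (A C : nat -> 'M[R]_n)
    (alpha : R) (alpha_ge0 : 0 <= alpha)
    (P : nat -> 'M[R]_n) (P_posdef : forall k, (k <= T)%N -> posdefmx (P k))
    (bound : (alpha + 1) ^+ T * c1 * lambda_max (P 0%N)
       - c2 * \big[Num.min/lambda_min (P 0%N)]_(k < T.+1) lambda_min (P k) < 0)
    (lmi : forall j, (j < T)%N ->
       negdefmx ((A j)^T *m sqrtmx (Q j.+1) *m P j.+1 *m sqrtmx (Q j.+1) *m A j
         + (C j)^T *m sqrtmx (Q j.+1) *m P j.+1 *m sqrtmx (Q j.+1) *m C j
         - (alpha + 1) *: (sqrtmx (Q j) *m P j *m sqrtmx (Q j)))) :
  finite_time_stable Pr (state A C w) c1 c2 T Q.
Proof.
move=> x0 x0c1.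
have w_var k : (k < T)%N -> ('E_Pr[(fun omega => w k omega ^+ 2)%R] = 1%:E)%E.
  move=> kT; under eq_fun do rewrite expr2.
  by rewrite w_cov // eqxx.
pose x := state A C w x0.
pose W k := sqrtmx (Q k) *m P k *m sqrtmx (Q k).
pose m (M : 'M[R]_n) k :=
  fine ('E_Pr[(fun omega => quadform M (x k omega))%R])%E.
have ix k M : (k <= T)%N ->
    Pr.-integrable setT (fun omega => (quadform M (x k omega))%:E).
  exact: integrable_state.
have mE k M : (k <= T)%N ->
    ('E_Pr[(fun omega => quadform M (x k omega))%R] = (m M k)%:E)%E.
  move=> kT; rewrite fineK // unlock.
  by have := integrable_fin_num measurableT (ix k M kT).
have m_le k M a N b : (k <= T)%N ->
    (forall y, a * quadform M y <= b * quadform N y) -> a * m M k <= b * m N k.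
  move=> kT MN; rewrite -lee_fin !EFinM -!mE // unlock.
  rewrite -!integralZl // ?ix //.
  apply: le_integral => //.
  - by apply: integrableZl => //; exact: ix.
  - by apply: integrableZl => //; exact: ix.
  - by move=> omega _; rewrite -!EFinM lee_fin.
have lmi_le k y : (k < T)%N ->
    quadform ((A k)^T *m W k.+1 *m A k + (C k)^T *m W k.+1 *m C k) y <=
    (alpha + 1) * quadform (W k) y.
  move=> kT; have := negdefmx_le0 y (lmi _ kT).
  by rewrite quadformD quadformN quadformZ subr_le0 /W !mulmxA.
have alpha1 : 1 <= alpha + 1 by rewrite lerDr.
have mW k : (k <= T)%N -> m (W k) k <= (alpha + 1) ^+ k * m (W 0%N) 0%N.
  elim: k => [|k IHk] kT; first by rewrite expr0 mul1r.
  (* The factor 1 gives this the shape of the conclusion of m_le. *)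
  have -> : m (W k.+1) k.+1 =
      1 * m ((A k)^T *m W k.+1 *m A k + (C k)^T *m W k.+1 *m C k) k.
    rewrite mul1r /m; congr fine.
    exact: (state_expectation w_indep w_mean w_var).
  apply: (@le_trans _ _ ((alpha + 1) * m (W k) k)).
    by apply: m_le (ltnW kT) _ => y; rewrite mul1r lmi_le.
  rewrite exprS -mulrA ler_wpM2l ?IHk 1?ltnW //.
  exact: le_trans ler01 alpha1.
set lmax := lambda_max (P 0%N) in bound *.
set lmin := \big[_/_]_(_ < _) _ in bound.
have lmin_gt0 k : (k <= T)%N -> 0 < lambda_min (P k).
  move=> kT; have Pk := P_posdef _ kT.
  exact: posdefmx_eigenvalue_gt0 Pk (lambda_minP Pk.1 n_gt0).1.
have lmin0 : 0 < lmin.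
  by apply: lt_bigmin => [|i _]; apply: lmin_gt0 => //; rewrite -ltnS.
have lmax0 : 0 <= lmax.
  have P0 := P_posdef _ (leq0n T).
  apply: le_trans (ltW (lmin_gt0 0%N (leq0n T))) _.
  exact: lambda_max_ge P0.1 n_gt0 (lambda_minP P0.1 n_gt0).1.
have m0 : m (W 0%N) 0%N <= lmax * c1.
  have -> : m (W 0%N) 0%N = quadform (W 0%N) x0.
    by rewrite -[RHS]/(fine (_%:E)) -(expectation_cst Pr).
  have Q0 := Q_posdef _ (leq0n T); have P0 := P_posdef _ (leq0n T).
  apply: le_trans (weighted_le x0 n_gt0 Q0 P0) _.
  exact: ler_wpM2l.
(* The claim, multiplied by lmin > 0, follows from the chain
   lmin E x_k' Q_k x_k <= E V_k(x_k) <= (alpha + 1)^k V_0(x_0)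
   <= (alpha + 1)^T c1 lmax < c2 lmin. *)
move=> k kT; rewrite mE // lte_fin -(ltr_pM2l lmin0).
have Qk := Q_posdef k kT; have Pk := P_posdef k kT.
apply: (@le_lt_trans _ _ (1 * m (W k) k)).
  apply: m_le => // y; rewrite mul1r.
  apply: le_trans (weighted_ge y n_gt0 Qk Pk); apply: ler_wpM2r.
    by rewrite (quadform_weight _ n_gt0 Qk) quadform1_ge0.
  exact: (bigmin_le _ (Ordinal (kT : (k < T.+1)%N))).
rewrite mul1r; apply: le_lt_trans (mW k kT) _.
apply: (@le_lt_trans _ _ ((alpha + 1) ^+ T * c1 * lmax)); last first.
  by rewrite -subr_lt0 (mulrC lmin).
rewrite -mulrA (mulrC c1).
apply: (@le_trans _ _ ((alpha + 1) ^+ k * (lmax * c1))).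
  by apply: ler_wpM2l => //; rewrite exprn_ge0 // (le_trans ler01).
by apply: ler_wpM2r; [rewrite mulr_ge0 // ltW | exact: ler_weXn2l].
Qed.
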